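(* Let $N\ge2$, let $d_1,\ldots,d_N$ be positive integers, and let $\psi=(\psi_{j_1\cdots j_N})$ be a $d_1\times\cdots\times d_N$ tensor of indeterminates. Let $\succ$ be the lexicographic term order on $\mathbb{C}[\psi]$ induced by the following total order of the variables: $\psi_{j_1\cdots j_N}\succ\psi_{j_1'\cdots j_N'}$ if $(j_2,\ldots,j_{N-1})<_{\mathrm{lex}}(j_2',\ldots,j_{N-1}')$, or if these tuples are equal and $j_1<j_1'$, or if these tuples are equal and $j_1=j_1'$ and $j_N<j_N'$. Then $\succ$ is a diagonal order on each flattening matrix $\psi^{(i)}$, $i=1,\ldots,N-1$; that is, for any minor of any of the matrices $\psi^{(i)}$, the leading monomial with respect to $\succ$ is the product of the diagonal entries of the submatrix whose determinant is that minor.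
   Context: For $1\le i\le N-1$, $\psi^{(i)}$ is the $(d_1\cdots d_i)\times(d_{i+1}\cdots d_N)$ matrix with rows indexed by $(j_1,\ldots,j_i)$, columns indexed by $(j_{i+1},\ldots,j_N)$ and entries $\psi_{j_1\cdots j_N}$, with rows and columns ordered as follows. Row $(j_1,\ldots,j_i)$ comes before (above) row $(j_1',\ldots,j_i')$ if $(j_2,\ldots,j_i)<_{\mathrm{lex}}(j_2',\ldots,j_i')$, or if these tuples are equal and $j_1<j_1'$. Column $(j_{i+1},\ldots,j_N)$ comes before (to the left of) column $(j_{i+1}',\ldots,j_N')$ if $(j_{i+1},\ldots,j_{N-1})<_{\mathrm{lex}}(j_{i+1}',\ldots,j_{N-1}')$, or if these tuples are equal and $j_N<j_N'$. Equivalently, $\psi^{(i)}$ is a block matrix whose blocks are the $d_1\times d_N$ ''pages'' $A_{j_2\cdots j_{N-1}}=(\psi_{j_1j_2\cdots j_N})_{j_1,j_N}$, with block-rows indexed by $(j_2,\ldots,j_i)$ and block-columns indexed by $(j_{i+1},\ldots,j_{N-1})$, both in lexicographic order. Here tuples are compared by $<_{\mathrm{lex}}$ from the first coordinate on, and submatrices inherit the order of rows and columns. *)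

(* Defs.v *)
From HB Require Import structures.
From mathcomp Require Import all_boot all_order all_algebra.
From mathcomp Require Import mpoly.

Set Implicit Arguments.
Unset Strict Implicit.
Unset Printing Implicit Defensive.

Import Order.TTheory GRing.Theory.
Local Open Scope ring_scope.

(* Positions and entries of multi-indices are numbered from 0: the index       *)
(* (j_1, ..., j_N) with 1 <= j_k <= d_k becomes a function j with              *)
(* j k < d k for k : 'I_N, and j_1 and j_N are j at positions 0 and N - 1.     *)

Definition multi_index (N : nat) (d : 'I_N -> nat) : finType :=
  {dffun forall k : 'I_N, 'I_(d k)}.

Definition row_index (N : nat) (d : 'I_N -> nat) (i : nat) : finType :=
  {dffun forall k : {k : 'I_N | (k < i)%N}, 'I_(d (val k))}.

Definition col_index (N : nat) (d : 'I_N -> nat) (i : nat) : finType :=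
  {dffun forall k : {k : 'I_N | (i <= k)%N}, 'I_(d (val k))}.

Definition join_index (N : nat) (d : 'I_N -> nat) (i : nat)
    (r : row_index d i) (c : col_index d i) : multi_index d :=
  [ffun k : 'I_N =>
     match leqP i k with
     | LeqNotGtn ik => c (exist _ k ik)
     | GtnNotLeq ki => r (exist _ k ki)
     end].

(* The tuple of coordinates of an index, read by increasing position. *)
Definition word (N : nat) (d : 'I_N -> nat) (j : multi_index d) : seq nat :=
  [seq val (j k) | k <- enum 'I_N].

Definition row_word (N : nat) (d : 'I_N -> nat) (i : nat)
    (r : row_index d i) : seq nat :=
  [seq val (r k) | k <- enum {: {k : 'I_N | (k < i)%N}}].

Definition col_word (N : nat) (d : 'I_N -> nat) (i : nat)
    (c : col_index d i) : seq nat :=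
  [seq val (c k) | k <- enum {: {k : 'I_N | (i <= k)%N}}].

Definition lex_lt (s t : seqlexi nat) : bool := (s < t)%O.

Definition front (s : seq nat) : seq nat := take (size s).-1 s.

Definition row_before (N : nat) (d : 'I_N -> nat) (i : nat) :
    rel (row_index d i) :=
  fun r r' =>
    let s := row_word r in let s' := row_word r' in
    lex_lt (behead s) (behead s')
    || (behead s == behead s') && (head 0 s < head 0 s')%N.

Definition col_before (N : nat) (d : 'I_N -> nat) (i : nat) :
    rel (col_index d i) :=
  fun c c' =>
    let s := col_word c in let s' := col_word c' in
    lex_lt (front s) (front s')
    || (front s == front s') && (last 0 s < last 0 s')%N.

Definition row_list (N : nat) (d : 'I_N -> nat) (i : nat) :
    seq (row_index d i) :=
  sort (fun r r' => (r == r') || row_before r r') (enum {: row_index d i}).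

Definition col_list (N : nat) (d : 'I_N -> nat) (i : nat) :
    seq (col_index d i) :=
  sort (fun c c' => (c == c') || col_before c c') (enum {: col_index d i}).

Lemma card_sub_index (N : nat) (d : 'I_N -> nat) (A : pred 'I_N) :
  #|{dffun forall k : {k : 'I_N | A k}, 'I_(d (val k))}|
  = (\prod_(k < N | A k) d k)%N.
Proof.
rewrite card_dep_ffun foldrE big_image /=.
under eq_bigr do rewrite card_ord.
rewrite (reindex_omap (val : {k | A k} -> 'I_N) insub) => [|k Ak].
  by apply: eq_bigl => k; rewrite valP valK eqxx.
by rewrite insubT.
Qed.

Lemma size_row_list (N : nat) (d : 'I_N -> nat) (i : nat) :
  size (row_list d i) == (\prod_(k < N | (k < i)%N) d k)%N.
Proof. by rewrite size_sort -cardE card_sub_index. Qed.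

Lemma size_col_list (N : nat) (d : 'I_N -> nat) (i : nat) :
  size (col_list d i) == (\prod_(k < N | (i <= k)%N) d k)%N.
Proof. by rewrite size_sort -cardE card_sub_index. Qed.

Definition row_tuple (N : nat) (d : 'I_N -> nat) (i : nat) :=
  Tuple (size_row_list d i).

Definition col_tuple (N : nat) (d : 'I_N -> nat) (i : nat) :=
  Tuple (size_col_list d i).

(* mpoly numbers its variables; the variable attached to v : V is the one      *)
(* numbered enum_rank v.                                                       *)
Definition indeterminate (K : comNzRingType) (V : finType) (v : V) :
    {mpoly K[#|V|]} :=
  'X_(enum_rank v).

Definition flattening (K : comNzRingType) (N : nat) (d : 'I_N -> nat) (i : nat) :
    'M[{mpoly K[#|multi_index d|]}]_(\prod_(k < N | (k < i)%N) d k,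
                                     \prod_(k < N | (i <= k)%N) d k) :=
  \matrix_(a, b)
    indeterminate K (join_index (tnth (row_tuple d i) a) (tnth (col_tuple d i) b)).

(* Strict order on the variables, the larger variable first. *)
Definition var_gt (N : nat) (d : 'I_N -> nat) : rel (multi_index d) :=
  fun j j' =>
    let s := word j in let s' := word j' in
    let inner t := behead (front t) in
    [|| lex_lt (inner s) (inner s'),
        (inner s == inner s') && (head 0 s < head 0 s')%N
      | [&& inner s == inner s', head 0 s == head 0 s'
          & (last 0 s < last 0 s')%N]].

(* Lexicographic term order induced by a strict total order gt on variables:   *)
(* m is larger than m' when the largest variable on which their exponents      *)
(* differ has the larger exponent in m.                                        *)
Definition lex_term_gt (V : finType) (gt : rel V) : rel 'X_{1..#|V|} :=
  fun m m' =>
    [exists v : V,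
       (m' (enum_rank v) < m (enum_rank v))%N
       && [forall w : V, gt w v ==> (m (enum_rank w) == m' (enum_rank w))]].

Definition is_leading_monomial (K : comNzRingType) (n : nat)
    (gt : rel 'X_{1..n}) (p : {mpoly K[n]}) (m : 'X_{1..n}) : Prop :=
  m \in msupp p /\ forall m', m' \in msupp p -> m' != m -> gt m m'.

Definition diagonal_order (K : comNzRingType) (n : nat) (gt : rel 'X_{1..n})
    (p q : nat) (A : 'M[{mpoly K[n]}]_(p, q)) : Prop :=
  forall (k : nat) (f : 'I_k -> 'I_p) (g : 'I_k -> 'I_q),
    {homo f : a b / (a < b)%N} -> {homo g : a b / (a < b)%N} ->
    exists2 m, is_leading_monomial gt (\det (mxsub f g A)) m
             & 'X_[K, m] = \prod_(a < k) (mxsub f g A) a a.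

(* Main.v *)
(* The monomials of a minor are the products of the entries (a, s a) over the  *)
(* permutations s.  If s <> 1 and a is the first index moved by s, the         *)
(* monomial of s and the diagonal one agree on every variable lying in a row   *)
(* or a column of index < a, and only the diagonal one contains the variable   *)
(* at (a, a).  So it suffices that the corner entry of every submatrix of a    *)
(* flattening is its largest variable, which holds because the key             *)
(* (inner indices, (j_1, j_N)) of a variable is monotone in the keys           *)
(* ((j_2..j_i), j_1) of its row and ((j_(i+1)..j_(N-1)), j_N) of its column.   *)

Require Import Defs.
From mathcomp Require Import all_boot all_order all_algebra.
From mathcomp Require Import fingroup perm mpoly.
From mathcomp Require Import complex reals.

Set Implicit Arguments.
Unset Strict Implicit.
Unset Printing Implicit Defensive.

Import Order.TTheory GRing.Theory.

(** Two independent facts combine. First, [diagonal_leading]: in a square matrix of distinct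
    indeterminates where [v a a] is the largest variable of the block of rows and columns from [a]
    on, the diagonal product leads the determinant; [perm_monomial_gt] compares it with the monomial
    of any other permutation. Second, the flattenings satisfy this: their rows and columns are
    sorted by [row_key] and [col_key], and [var_key_join_homo] shows that the key of an entry grows
    weakly with both, a smaller key meaning a larger variable. Hence moving down or right never
    reaches a larger variable. *)

Section DiagonalLeading.

Variables (K : comNzRingType) (V : finType) (gt : rel V) (k : nat).
Variable v : 'I_k -> 'I_k -> V.
Hypothesis v_inj : forall a b a' b', v a b = v a' b' -> a = a' /\ b = b'.

Local Open Scope ring_scope.

Definition perm_monomial (s : {perm 'I_k}) : 'X_{1..#|V|} :=
  (\sum_(a < k) U_(enum_rank (v a (s a))))%MM.

Lemma perm_monomialE s b c : perm_monomial s (enum_rank (v b c)) = (s b == c).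
Proof.
rewrite mnm_sumE (bigD1 b) //= big1 => [|a ab]; rewrite mnmE (inj_eq enum_rank_inj).
  rewrite addn0; congr nat_of_bool; apply/eqP/eqP => [/v_inj[]//|->//].
by case: eqP => // /v_inj[ba]; rewrite ba eqxx in ab.
Qed.

Lemma perm_monomial_out s w :
  (forall b c, w != v b c) -> perm_monomial s (enum_rank w) = 0%N.
Proof.
move=> wN; rewrite mnm_sumE big1 // => a _.
by rewrite mnmE (inj_eq enum_rank_inj) eq_sym (negPf (wN _ _)).
Qed.

Lemma prod_indeterminate (s : {perm 'I_k}) :
  \prod_(a < k) indeterminate K (v a (s a)) = 'X_[perm_monomial s].
Proof. by rewrite /indeterminate mprodXE. Qed.

Hypothesis v_corner : forall a b c : 'I_k,
  (a <= b)%N -> (a <= c)%N -> ~~ gt (v b c) (v a a).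

Lemma perm_monomial_gt (s : {perm 'I_k}) :
  s != 1%g -> lex_term_gt gt (perm_monomial 1%g) (perm_monomial s).
Proof.
move=> s1; have [a0 a0P] : exists a, s a != a.
  apply/existsP; rewrite -negb_forall; apply: contraNN s1 => /forallP fs.
  by apply/eqP/permP => a; rewrite perm1; apply/eqP.
case: (@arg_minnP _ a0 (fun a => s a != a) val a0P) => a saN amin.
have fixed (b : 'I_k) : (b < a)%N -> s b = b.
  by move=> ba; apply: contraTeq ba => /amin; rewrite -leqNgt.
apply/existsP; exists (v a a); rewrite !perm_monomialE perm1 eqxx (negPf saN) /=.
apply/forallP => w; apply/implyP => wgt.
case: (boolP [exists b, exists c, w == v b c]) => [|wN]; last first.
  have wN' b c : w != v b c.
    by apply: contraNN wN => wE; apply/existsP; exists b; apply/existsP; exists c.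
  by rewrite !perm_monomial_out.
case/existsP=> b /existsP[c /eqP wE]; move: wgt; rewrite {w}wE => wgt.
rewrite !perm_monomialE perm1.
(* If [b < a], then [s b = b]; if [c < a], then [s c = c], so [s b = c] only when [b = c]. Either
   way the exponents agree. Otherwise the entry lies in the block with corner [(a, a)]. *)
case: (ltnP b a) => [/fixed->//|ab]; case: (ltnP c a) => [/fixed sc|ac].
  by rewrite -{2}sc (inj_eq perm_inj).
by have := v_corner ab ac; rewrite wgt.
Qed.

(** By strictness of [perm_monomial_gt] only the identity yields the diagonal monomial, so its
    coefficient is 1 over any [K]; terms of other permutations may cancel among themselves, but none
    exceeds it. *)
Lemma diagonal_leading (A : 'M[{mpoly K[#|V|]}]_k) :
    (forall a b, A a b = indeterminate K (v a b)) ->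
  exists2 m, is_leading_monomial (lex_term_gt gt) (\det A) m
           & 'X_[K, m] = \prod_(a < k) A a a.
Proof.
move=> AE; exists (perm_monomial 1%g); last first.
  by rewrite -prod_indeterminate; apply: eq_bigr => a _; rewrite perm1 AE.
have detE m : (\det A)@_m = \sum_(s : {perm 'I_k}) (-1) ^+ s * (perm_monomial s == m)%:R.
  rewrite raddf_sum; apply: eq_bigr => s _ /=.
  under eq_bigr do rewrite AE.
  rewrite prod_indeterminate.
  by case: (odd_perm s); rewrite ?expr1 ?expr0 ?mulN1r ?mul1r ?mcoeffN mcoeffX.
split=> [|m]; rewrite mcoeff_msupp detE.
  rewrite (bigD1 1%g) //= odd_perm1 eqxx mulr1 big1 ?addr0 ?oner_eq0 // => s s1.
  case: eqP => [sE|]; last by rewrite mulr0.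
  have /existsP[w /andP[]] := perm_monomial_gt s1.
  by rewrite sE ltnn.
move=> nz mN; case: (boolP [exists s : {perm 'I_k}, perm_monomial s == m]) => [|mN'].
  case/existsP=> s /eqP sm; rewrite -sm; apply: perm_monomial_gt.
  by apply: contraNN mN => /eqP s1; rewrite -sm s1.
case/eqP: nz; rewrite big1 // => s _.
by case: eqP => [sm|]; rewrite ?mulr0 //; case/existsP: mN'; exists s; apply/eqP.
Qed.

End DiagonalLeading.

(** * Lexicographic comparison and lists sorted by a key *)

Section Lexicographic.

Local Open Scope order_scope.

Lemma ltxi_pair_eq d1 d2 d3 (T1 : orderType d1) (T2 : orderType d2)
    (x1 y1 : T1) (x2 y2 : T2) :
  ((x1, x2) : T1 *lexi[d3] T2) < (y1, y2)
  = (x1 < y1) || (x1 == y1) && (x2 < y2).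
Proof. by rewrite ltxi_pair; case: (ltgtP x1 y1). Qed.

Lemma lexi_pair_eq d1 d2 d3 (T1 : orderType d1) (T2 : orderType d2)
    (x1 y1 : T1) (x2 y2 : T2) :
  ((x1, x2) : T1 *lexi[d3] T2) <= (y1, y2)
  = (x1 < y1) || (x1 == y1) && (x2 <= y2).
Proof. by rewrite lexi_pair; case: (ltgtP x1 y1). Qed.

Lemma ltxi_cat (s t s' t' : seqlexi nat) : size s = size s' ->
  (s ++ t : seqlexi nat) < (s' ++ t' : seqlexi nat)
  = (s < s') || (s == s') && (t < t').
Proof.
elim: s s' => [|x s IH] [|y s'] //= [ss'].
by rewrite !ltxi_cons IH // eqseq_cons; case: (ltgtP x y).
Qed.

(** Sorting gives weak monotonicity; strictness comes from the list having no repetitions and the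
    key being injective. *)
Lemma sort_key_homo (T : finType) d (U : orderType d) (key : T -> U)
    (e : rel T) (n : nat) (t : n.-tuple T) :
    injective key -> (forall x y, e x y = (key x < key y)) ->
    t = sort (fun x y => (x == y) || e x y) (enum T) :> seq T ->
  forall a b : 'I_n, (a < b)%N -> key (tnth t a) < key (tnth t b).
Proof.
move=> key_inj eE tE a b ab.
have leE x y : (x == y) || e x y = (key x <= key y).
  by rewrite eE le_eqVlt (inj_eq key_inj).
have e_tot : total (fun x y => (x == y) || e x y).
  by move=> x y; rewrite !leE le_total.
have e_trans : transitive (fun x y => (x == y) || e x y).
  by move=> y x z; rewrite !leE; apply: le_trans.
have t_uniq : uniq t by rewrite tE sort_uniq enum_uniq.
have x0 := tnth t a.
rewrite lt_neqAle (inj_eq key_inj) !(tnth_nth x0).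
rewrite nth_uniq ?size_tuple ?ltn_ord // (ltn_eqF ab) /= -leE.
apply: (sorted_ltn_nth e_trans) => //; rewrite ?inE ?size_tuple ?ltn_ord //.
by rewrite tE sort_sorted.
Qed.

End Lexicographic.

(** * Splitting the positions of a multi-index into row and column positions *)

Lemma map_enum_sig (T : finType) (P : pred T) (U : Type) (F : T -> U) :
  [seq F (val x) | x <- enum {: {x | P x}}] = [seq F x | x <- enum P].
Proof.
suff <- : [seq val x | x <- enum {: {x | P x}}] = enum P by rewrite -[RHS]map_comp.
rewrite enumT unlock /= (pmap_filter (insubK _)).
by rewrite /enum_mem; apply: eq_filter => x; apply: isSome_insub.
Qed.

Lemma word_inj (I : finType) (d : I -> nat) :
  injective (fun f : {dffun forall k, 'I_(d k)} => [seq val (f k) | k <- enum I]).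
Proof.
move=> f g /eq_in_map fg; apply/ffunP => k.
by apply/val_inj/fg; rewrite mem_enum.
Qed.

Lemma enum_ord_split N i :
  enum 'I_N = enum (fun k : 'I_N => k < i) ++ enum (fun k : 'I_N => i <= k).
Proof.
apply: (inj_map val_inj); rewrite map_cat.
have enumE (P : pred nat) :
    [seq val k | k <- enum (fun k : 'I_N => P k)] = filter P (iota 0 N).
  by rewrite -val_enum_ord filter_map enumT.
rewrite (enumE (fun k => k < i)) (enumE (fun k => i <= k)) val_enum_ord.
(* The start of the interval is generalized to [m]; once [i <= m], the first filter is empty and the
   second keeps everything. *)
elim: N 0 {enumE} => [|N IH] m //=; case: ltnP => mi /=; first by rewrite -IH.
rewrite (@eq_in_filter _ (fun k => k < i) pred0); last first.
  move=> k; rewrite mem_iota => /andP[mk _]; apply/negbTE.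
  by rewrite -leqNgt (leq_trans mi) // ltnW.
rewrite filter_pred0 /=; congr cons; apply/esym/all_filterP/allP => k.
by rewrite mem_iota => /andP[mk _]; rewrite (leq_trans mi) // ltnW.
Qed.

(** * Keys for the rows, columns and variables of a flattening *)

Section FlatteningOrder.

Variables (N : nat) (d : 'I_N -> nat) (i : nat).

Definition row_key (r : row_index d i) : seqlexi nat *l nat :=
  (behead (row_word r), head 0 (row_word r)).

Definition col_key (c : col_index d i) : seqlexi nat *l nat :=
  (front (col_word c), last 0 (col_word c)).

Definition var_key (j : multi_index d) : seqlexi nat *l (nat *l nat) :=
  (behead (front (word j)), (head 0 (word j), last 0 (word j))).

Lemma row_beforeE r r' : row_before r r' = (row_key r < row_key r')%O.
Proof. by rewrite ltxi_pair_eq. Qed.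

Lemma col_beforeE c c' : col_before c c' = (col_key c < col_key c')%O.
Proof. by rewrite ltxi_pair_eq. Qed.

Lemma var_gtE j j' : var_gt j j' = (var_key j < var_key j')%O.
Proof.
rewrite ltxi_pair_eq ltxi_pair_eq /var_gt /lex_lt.
by rewrite andb_orr.
Qed.

Lemma join_index_row (r : row_index d i) (c : col_index d i) (k : {k : 'I_N | k < i}) :
  val (join_index r c (val k)) = val (r k).
Proof.
case: k => k ki; rewrite ffunE /=; case: leqP => [ik|ki'].
  by have := leq_ltn_trans ik ki; rewrite ltnn.
by rewrite (bool_irrelevance ki' ki).
Qed.

Lemma join_index_col (r : row_index d i) (c : col_index d i) (k : {k : 'I_N | i <= k}) :
  val (join_index r c (val k)) = val (c k).
Proof.
case: k => k ik; rewrite ffunE /=; case: leqP => [ik'|ki].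
  by rewrite (bool_irrelevance ik' ik).
by have := leq_ltn_trans ik ki; rewrite ltnn.
Qed.

Lemma word_join (r : row_index d i) (c : col_index d i) :
  word (join_index r c) = row_word r ++ col_word c.
Proof.
rewrite /word (enum_ord_split N i) map_cat.
rewrite -(map_enum_sig (fun k : 'I_N => k < i)).
rewrite -(map_enum_sig (fun k : 'I_N => i <= k)).
congr (_ ++ _); apply: eq_map => k; [exact: join_index_row | exact: join_index_col].
Qed.

Lemma join_index_inj (r r' : row_index d i) (c c' : col_index d i) :
  join_index r c = join_index r' c' -> r = r' /\ c = c'.
Proof.
move=> /(congr1 (@word _ _))/eqP; rewrite !word_join eqseq_cat; last first.
  by rewrite !size_map.
by case/andP => /eqP/word_inj-> /eqP/word_inj->.
Qed.

Hypothesis i_bounds : 0 < i < N.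

Lemma row_word_cons (r : row_index d i) :
  row_word r = head 0 (row_word r) :: behead (row_word r).
Proof.
have /andP[i_gt0 iN] := i_bounds.
have : 0 < size (row_word r).
  rewrite size_map -cardE; apply/card_gt0P.
  by exists (exist _ (Ordinal (ltn_trans i_gt0 iN)) i_gt0).
by case: (row_word r).
Qed.

Lemma col_word_rcons (c : col_index d i) :
  col_word c = rcons (front (col_word c)) (last 0 (col_word c)).
Proof.
have /andP[_ iN] := i_bounds.
have : 0 < size (col_word c).
  rewrite size_map -cardE; apply/card_gt0P.
  by exists (exist _ (Ordinal iN) (leqnn i)).
case/lastP: (col_word c) => [//|q l] _.
by rewrite last_rcons /front size_rcons -[rcons q l]cats1 take_size_cat // cats1.
Qed.

Lemma row_key_inj : injective row_key.
Proof.
move=> r r' [bE hE]; apply: word_inj.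
by rewrite -!/(row_word _) row_word_cons bE hE -row_word_cons.
Qed.

Lemma col_key_inj : injective col_key.
Proof.
move=> c c' [fE lE]; apply: word_inj.
by rewrite -!/(col_word _) col_word_rcons fE lE -col_word_rcons.
Qed.

(** Since [0 < i < N], both words are nonempty, so the first coordinate is removed from the row part
    and the last from the column part. *)
Lemma var_key_join (r : row_index d i) (c : col_index d i) :
  var_key (join_index r c)
  = (behead (row_word r) ++ front (col_word c),
     (head 0 (row_word r), last 0 (col_word c))).
Proof.
rewrite /var_key; have -> : word (join_index r c) =
    head 0 (row_word r) ::
      rcons (behead (row_word r) ++ front (col_word c)) (last 0 (col_word c)).
  by rewrite rcons_cat -col_word_rcons -cat_cons -row_word_cons word_join.
by rewrite /= last_rcons /front /= size_rcons /= -cats1 take_size_cat.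
Qed.

(** The inner parts of the rows have equal length, so a strict inequality there decides, then one
    between those of the columns. Only if both tie do the end coordinates count, and then both
    weakly increase. *)
Lemma var_key_join_homo (r r' : row_index d i) (c c' : col_index d i) :
  (row_key r <= row_key r')%O -> (col_key c <= col_key c')%O ->
  (var_key (join_index r c) <= var_key (join_index r' c'))%O.
Proof.
rewrite !var_key_join /row_key /col_key !lexi_pair_eq ltxi_cat; last first.
  by rewrite !size_behead !size_map.
case/orP=> [->//|/andP[/eqP-> hh]]; case/orP=> [->|/andP[/eqP-> ll]].
  by rewrite eqxx orbT.
by rewrite !ltxx !eqxx /= ll andbT orbC -le_eqVlt.
Qed.

End FlatteningOrder.

Theorem proposition6p4 (R : realType) (N : nat) (d : 'I_N -> nat)
    (hN : (2 <= N)%N) (hd : forall k : 'I_N, (0 < d k)%N)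
    (i : nat) (hi : (1 <= i <= N - 1)%N) :
  diagonal_order (lex_term_gt (@var_gt N d)) (flattening (complex R) d i).
Proof.
move=> k f g f_homo g_homo.
have i_bounds : 0 < i < N.
  by case/andP: hi => -> iN; rewrite (leq_ltn_trans iN) // subn1 prednK // ltnW.
pose r a := tnth (row_tuple d i) (f a); pose c b := tnth (col_tuple d i) (g b).
(* The [mono] form serves twice: it gives injectivity, hence distinct entries, and the weak
   comparisons for the corner condition. *)
have r_mono : {mono (fun a => row_key (r a)) : a b / (a <= b)%O}.
  apply: le_mono => a b ab.
  exact: (sort_key_homo (t := row_tuple d i) (row_key_inj i_bounds)
          (@row_beforeE N d i) erefl (f_homo _ _ ab)).
have c_mono : {mono (fun a => col_key (c a)) : a b / (a <= b)%O}.
  apply: le_mono => a b ab.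
  exact: (sort_key_homo (t := col_tuple d i) (col_key_inj i_bounds)
          (@col_beforeE N d i) erefl (g_homo _ _ ab)).
apply: (@diagonal_leading _ _ _ _ (fun a b => join_index (r a) (c b))).
- move=> a b a' b' /join_index_inj[rE cE].
  by split; [apply: (inc_inj r_mono) | apply: (inc_inj c_mono)]; rewrite ?rE ?cE.
- move=> a b b' ab ab'; rewrite var_gtE -leNgt.
  by apply: var_key_join_homo; rewrite // ?r_mono ?c_mono.
by move=> a b; rewrite !mxE.
Qed.
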